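(* Suppose $n\ge 3$ is an integer and $1\le m\le n$. Let $\mathcal{S}_{n,m}$ be the collection of all sets of vertices of the $n$-cycle $C_n$ of cardinality $m$ which maximize the sum of distances $S$ (among all sets of vertices of $C_n$ of cardinality $m$). Then a set of vertices $A\subseteq V(C_n)$ of size $m$ is maximally even if and only if $\vec{D}(A)\prec\vec{D}(B)$ for all $B\in\mathcal{S}_{n,m}$.
   Context: The $n$-cycle $C_n$ has vertex set $\{0,1,\ldots,n-1\}$, with $i$ adjacent to $i+1$ modulo $n$. The distance between two vertices $u\neq v$ is the number of edges in a shortest path from $u$ to $v$. Maximally even: a set of vertices in $C_n$ with cardinality $m$ is maximally even if it is of the form $$J^r_{n,m}=\left\{\left\lfloor\frac{ni+r}{m}\right\rfloor : i=0,1,\ldots,m-1\right\}$$ for some integer $r$ with $0\le r\le n-1$. Distance vector and sum of distances: for a set $A$ of vertices with $|A|=m$, the distance vector of $A$ is the tuple $\vec{D}(A)=(d_1,\ldots,d_\ell)$ of all distances between (unordered) pairs of distinct elements of $A$, listed with multiplicity and with $d_1\le\cdots\le d_\ell$, where $\ell=\binom{m}{2}$. The sum of distances of $A$ is $S(A)=d_1+\cdots+d_\ell$. A set $A$ maximizes $S$ if $S(A)\ge S(B)$ for every set $B$ of vertices with $|B|=|A|$. Majorization: for an $\ell$-tuple of real numbers $x=(x_1,\ldots,x_\ell)$, let $x^\downarrow=(x_1^\downarrow,\ldots,x_\ell^\downarrow)$ be the tuple with the same entries rearranged so that $x_1^\downarrow\ge\cdots\ge x_\ell^\downarrow$. For $\ell$-tuples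 $x,y$ of real numbers, $x\prec y$ ($x$ is majorized by $y$) means that (1) $\sum_{i=1}^k x_i^\downarrow\le\sum_{i=1}^k y_i^\downarrow$ for $k=1,\ldots,\ell-1$, and (2) $\sum_{i=1}^\ell x_i^\downarrow=\sum_{i=1}^\ell y_i^\downarrow$. *)

(* Defs.v *)
From HB Require Import structures.
From mathcomp Require Import all_boot all_order all_algebra.
From mathcomp Require Import reals.
Set Implicit Arguments.
Unset Strict Implicit.
Unset Printing Implicit Defensive.
Import Order.TTheory GRing.Theory Num.Theory.

Local Open Scope nat_scope.

(* A path with k edges from u to v is u :: p with size p = k; in a finite graph
   it has fewer than #|T| edges.  The value is #|T| if v is unreachable. *)
Definition dist (T : finType) (e : rel T) (u v : T) : nat :=
  \big[minn/#|T|]_(k < #|T| | [exists p : k.-tuple T,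
      [&& path e u p, last u p == v & uniq (u :: p)]]) k.

(* [ordS] is the successor modulo n. *)
Definition cycle_adj (n : nat) : rel 'I_n :=
  fun i j => (j == ordS i) || (i == ordS j).

(* The unordered pairs of distinct vertices are listed as pairs u < v. *)
Definition distance_vector (n : nat) (A : {set 'I_n}) : seq nat :=
  sort leq [seq dist (@cycle_adj n) p.1 p.2 |
    p <- enum [set p : 'I_n * 'I_n | [&& p.1 \in A, p.2 \in A & p.1 < p.2]]].

Definition sum_dist (n : nat) (A : {set 'I_n}) : nat :=
  \sum_(d <- distance_vector A) d.

Definition maximizes_sum_dist (n : nat) (A : {set 'I_n}) : bool :=
  [forall B : {set 'I_n}, (#|B| == #|A|) ==> (sum_dist B <= sum_dist A)].

Definition sum_dist_maximizers (n m : nat) : {set {set 'I_n}} :=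
  [set B : {set 'I_n} | (#|B| == m) && maximizes_sum_dist B].

(* For r < n every value (n * i + r) %/ m with i < m is less than n, so the
   restriction of x to 'I_n loses nothing. *)
Definition Jset (n m r : nat) : {set 'I_n} :=
  [set x : 'I_n | [exists i : 'I_m, x == (n * i + r) %/ m :> nat]].

Definition maximally_even (n : nat) (A : {set 'I_n}) : Prop :=
  exists2 r : nat, r <= n - 1 & A = Jset n #|A| r.

Local Open Scope ring_scope.

Definition decreasing_rearrangement (R : realType) (x : seq R) : seq R :=
  sort (fun a b => b <= a) x.

Definition majorized (R : realType) (x y : seq R) : Prop :=
  let xd := decreasing_rearrangement x in
  let yd := decreasing_rearrangement y in
  [/\ size x = size y,
      forall k : nat, (1 <= k <= size x - 1)%N ->
        \sum_(0 <= i < k) xd`_i <= \sum_(0 <= i < k) yd`_i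
    & \sum_(0 <= i < size x) xd`_i = \sum_(0 <= i < size x) yd`_i].

Definition real_vector (R : realType) (s : seq nat) : seq R :=
  [seq d%:R | d <- s].

(* Main.v *)
Require Import Defs.
From mathcomp Require Import all_boot all_order all_algebra.
From mathcomp Require Import reals.
From mathcomp Require Import zify.

(** Write a set A of m vertices as a strictly increasing sequence a of integers
    with a (i + m) = a i + n, a winding of A around the cycle.  The pairs of
    points of A that are k steps apart along A have clockwise gaps
    a (i + k) - a i, and for fixed k these m gaps add up to n k, whatever A is
    ([sum_gap]).  Points at clockwise gap x are at distance min(x, n - x).

    Fix a cap t <= n / 2.  The function x |-> min(x, n - x, t) is concave and
    piecewise linear with integer breakpoints, so it has a supporting line that
    touches it at both ends of the window {q, q + 1}, where q = n k / m rounded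
    down.  Summing these linear bounds over the gaps and over k gives a bound on
    the sum of the capped distances min(d, t) that depends on n, m and t only,
    and equality means that every gap lies on its supporting line
    ([capped_sum_leqif]).

    If A is maximally even, each gap is q or q + 1 and all the bounds are
    attained.  Conversely, if the bounds are attained for every t, the values
    t next to q or n - q force each gap into {q, q + 1} ([eq_tangent_bounds]).
    As the gaps have mean n k / m, each then differs from n k / m by less than
    1; so the numbers m a i - n i lie in an interval of length less than m, and
    with r their maximum a i = (n i + r) / m rounded down ([balanced_Jset]).
    Hence A is maximally even if and only if its capped distance sums attain the
    bound for all t ([maximally_evenP]).

    For vectors with equal sums, x is majorized by y as soon as
    the sum of max(x_i - t, 0) is at most that of max(y_i - t, 0) for all t,
    that is, as soon as the sums of min(x_i, t) are at least those of
    min(y_i, t).  Thus a maximally even set, which maximizes all capped sums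
    (among them, for t large, the sum of distances), has a distance vector
    majorized by that of every maximizer B.  Conversely, let the distance
    vector of A be majorized by those of all maximizers; one of these is a
    maximally even set J.  Then A has the same sum of distances as J, hence is
    a maximizer itself, and the distance vectors of A and J majorize each
    other.  They are therefore equal, so A attains the same bounds as J and is
    maximally even. *)

Set Implicit Arguments.
Unset Strict Implicit.
Unset Printing Implicit Defensive.
Import Order.TTheory GRing.Theory Num.Theory.

(** * Majorization *)

Section Majorization.
Local Open Scope ring_scope.
Variable R : realType.
Implicit Types x y : seq R.

Lemma perm_decreasing_rearrangement x : perm_eq (decreasing_rearrangement x) x.
Proof. by rewrite perm_sort. Qed.

Lemma size_decreasing_rearrangement x :
  size (decreasing_rearrangement x) = size x.
Proof. exact: size_sort. Qed.

Lemma decreasing_rearrangement_nth x i j :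
  (i <= j)%N -> (j < size x)%N ->
  (decreasing_rearrangement x)`_j <= (decreasing_rearrangement x)`_i.
Proof.
move=> le_ij lt_jx.
have ge_total : total (fun a b : R => b <= a) by move=> a b; exact: le_total.
have ge_trans : transitive (fun a b : R => b <= a).
  by move=> b a c le_ba le_cb; exact: le_trans le_cb le_ba.
have ge_refl : reflexive (fun a b : R => b <= a) by move=> a; exact: lexx.
have sorted_x := sort_sorted ge_total x.
apply: (sorted_leq_nth ge_trans ge_refl 0 sorted_x) => //;
  rewrite inE size_sort //.
exact: leq_ltn_trans lt_jx.
Qed.

Lemma big_decreasing_rearrangement x (f : R -> R) :
  \sum_(a <- x) f a = \sum_(0 <= i < size x) f (decreasing_rearrangement x)`_i.
Proof.
rewrite -(perm_big _ (perm_decreasing_rearrangement x)) /=.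
by rewrite (big_nth 0) size_decreasing_rearrangement.
Qed.

(** The half of the Hardy-Littlewood-Polya criterion that turns inequalities
    between excess sums into majorization.  To compare the sums of the k largest
    entries, take t to be the k-th largest entry of y: the excess over t of y is
    then exactly its top sum minus k t, while that of x is at least its own. *)
Lemma majorized_of_excess x y :
  size x = size y ->
  \sum_(a <- x) a = \sum_(b <- y) b ->
  (forall t, t \in y ->
     \sum_(a <- x) Num.max 0 (a - t) <= \sum_(b <- y) Num.max 0 (b - t)) ->
  majorized x y.
Proof.
move=> eq_size eq_sum le_excess; split=> //; last first.
  by move: eq_sum; rewrite !(big_decreasing_rearrangement _ id) eq_size.
move=> k /andP[k_gt0 k_lt].
have k_le_x : (k <= size x)%N by lia.
have k_le_y : (k <= size y)%N by lia.
set xd := decreasing_rearrangement x; set yd := decreasing_rearrangement y.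
pose t := yd`_k.-1.
have t_in : t \in y.
  rewrite -(perm_mem (perm_decreasing_rearrangement y)) mem_nth //.
  by rewrite size_decreasing_rearrangement; lia.
have := le_excess _ t_in.
rewrite !big_decreasing_rearrangement -/xd -/yd.
rewrite (big_cat_nat (n := k) (p := size x)) //=.
rewrite (big_cat_nat (n := k) (p := size y)) //=.
have -> : \sum_(k <= i < size y) Num.max 0 (yd`_i - t) = 0.
  rewrite big_nat big1 // => i /andP[le_ki lt_iy].
  apply/max_idPl; rewrite subr_le0 decreasing_rearrangement_nth //; lia.
have -> : \sum_(0 <= i < k) Num.max 0 (yd`_i - t) = \sum_(0 <= i < k) (yd`_i - t).
  rewrite !big_nat; apply: eq_bigr => i /andP[_ lt_ik].
  by apply/max_idPr; rewrite subr_ge0 decreasing_rearrangement_nth //; lia.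
have le_x : \sum_(0 <= i < k) (xd`_i - t) <=
    \sum_(0 <= i < k) Num.max 0 (xd`_i - t).
  by apply: ler_sum => i _; rewrite le_max lexx orbT.
have ge0_x : 0 <= \sum_(k <= i < size x) Num.max 0 (xd`_i - t).
  by apply: sumr_ge0 => i _; rewrite le_max lexx.
move=> le_xy; move: (le_trans (lerD le_x ge0_x) le_xy).
by rewrite !addr0 !sumrB lerBlDr subrK.
Qed.

(** Mutual majorization equates all sums of the k largest entries, and the
    entries are the differences of consecutive such sums. *)
Lemma majorized_anti x y : majorized x y -> majorized y x -> perm_eq x y.
Proof.
case=> eq_size le_xy eq_sum [_ le_yx _].
set xd := decreasing_rearrangement x in le_xy le_yx eq_sum.
set yd := decreasing_rearrangement y in le_xy le_yx eq_sum.
have eq_top k : (k <= size x)%N ->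
    \sum_(0 <= i < k) xd`_i = \sum_(0 <= i < k) yd`_i.
  case: k => [|k] k_le; first by rewrite !big_geq.
  have [k_lt|->//] : (k.+1 <= size x - 1)%N \/ k.+1 = size x by lia.
  by apply/le_anti; rewrite le_xy ?le_yx // -?eq_size /= k_lt.
suff eq_d : xd = yd.
  apply: perm_trans (perm_decreasing_rearrangement y).
  by rewrite -/yd -eq_d perm_sym perm_decreasing_rearrangement.
apply: (@eq_from_nth _ 0); rewrite !size_decreasing_rearrangement // => i lt_i.
have := eq_top _ lt_i.
by rewrite !big_nat_recr //= eq_top 1?ltnW // => /addrI.
Qed.

Lemma sum_excess_real_vector (s : seq nat) (t : nat) :
  \sum_(a <- real_vector R s) Num.max 0 (a - t%:R) =
  (\sum_(d <- s) (d - t))%N%:R.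
Proof.
rewrite big_map natr_sum; apply: eq_bigr => d _.
have [le_dt|lt_td] := leqP d t.
  have /eqP -> : (d - t == 0)%N by rewrite subn_eq0.
  by apply/max_idPl; rewrite subr_le0 ler_nat.
by rewrite natrB 1?ltnW //; apply/max_idPr; rewrite subr_ge0 ler_nat ltnW.
Qed.

(** The excess of d over t is d - min(d, t), so for equal sums a smaller excess
    is a larger capped sum.  The entries being natural numbers, natural caps
    suffice. *)
Lemma majorized_real_vector (s s' : seq nat) :
  size s = size s' ->
  (\sum_(d <- s) d = \sum_(d <- s') d)%N ->
  (forall t, \sum_(d <- s') minn d t <= \sum_(d <- s) minn d t)%N ->
  majorized (real_vector R s) (real_vector R s').
Proof.
move=> eq_size eq_sum le_min; apply: majorized_of_excess.
- by rewrite !size_map.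
- by rewrite !big_map -!natr_sum eq_sum.
move=> _ /mapP[t _ ->]; rewrite !sum_excess_real_vector ler_nat.
have split_sum (u : seq nat) :
    (\sum_(d <- u) d = \sum_(d <- u) minn d t + \sum_(d <- u) (d - t))%N.
  by rewrite -big_split; apply: eq_bigr => d _ /=; lia.
move: eq_sum (le_min t); rewrite !split_sum; lia.
Qed.

Lemma natr_inj : injective (fun d : nat => d%:R : R).
Proof. by move=> d e /eqP; rewrite eqr_nat => /eqP. Qed.

Lemma perm_real_vector (s s' : seq nat) :
  perm_eq (real_vector R s) (real_vector R s') -> perm_eq s s'.
Proof. exact: (perm_map_inj (@natr_inj)). Qed.

Lemma majorized_sum_real_vector (s s' : seq nat) :
  majorized (real_vector R s) (real_vector R s') ->
  (\sum_(d <- s) d = \sum_(d <- s') d)%N.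
Proof.
case=> eq_size _; rewrite {2}eq_size -!(big_decreasing_rearrangement _ id) !big_map.
by rewrite -!natr_sum => eq_R; apply: natr_inj eq_R.
Qed.

End Majorization.

(** * Distances in the cycle *)

Definition arc_dist (n x y : nat) : nat :=
  minn ((x - y) + (y - x)) (n - ((x - y) + (y - x))).

Lemma bigminn_leq (I : eqType) (r : seq I) (P : pred I) (x : nat)
    (F : I -> nat) (i : I) :
  i \in r -> P i -> \big[minn/x]_(j <- r | P j) F j <= F i.
Proof.
elim: r => // j r IHr; rewrite inE big_cons => /predU1P[<- ->|r_i Pi].
  exact: geq_minl.
by case: ifP => _; [apply: leq_trans (geq_minr _ _) _ |]; exact: IHr.
Qed.

Section Cycle.
Variable n : nat.
Hypothesis n_gt2 : 2 < n.

Lemma val_ordS (i : 'I_n) : ordS i = (if i.+1 == n then 0 else i.+1) :> nat.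
Proof.
rewrite /=; case: eqP => [->|neq]; first by rewrite modnn.
by rewrite modn_small //; move: (ltn_ord i); lia.
Qed.

Lemma cycle_adjP (i j : 'I_n) :
  reflect ([\/ j = i.+1 :> nat, i = j.+1 :> nat,
             i = 0 :> nat /\ j = n.-1 :> nat
           | j = 0 :> nat /\ i = n.-1 :> nat])
          (cycle_adj i j).
Proof.
have lt_i := ltn_ord i; have lt_j := ltn_ord j.
rewrite /cycle_adj -!(inj_eq (@ord_inj n)) !val_ordS.
apply: (iffP orP) => [[/eqP|/eqP]|]; first (case: eqP => [e1|e1] e2).
- by apply: Or44; lia.
- by apply: Or41; lia.
- by case: eqP => [e1|e1] e2; [apply: Or43; lia | apply: Or42; lia].
by case=> ?; [left|right|right|left]; apply/eqP; case: eqP; lia.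
Qed.

Lemma arc_dist_step (u v w : 'I_n) :
  cycle_adj u v -> arc_dist n u w <= (arc_dist n v w).+1.
Proof.
have := (ltn_ord u, ltn_ord v, ltn_ord w); rewrite /arc_dist.
by case=> [[? ?] ?] /cycle_adjP[]; lia.
Qed.

(** An edge changes the arc distance to a fixed vertex by at most one, so no
    path is shorter than the arc distance of its ends. *)
Lemma arc_dist_path (u : 'I_n) (p : seq 'I_n) :
  path (@cycle_adj n) u p -> arc_dist n u (last u p) <= size p.
Proof.
elim: p u => [|v p IHp] u /=; first by rewrite /arc_dist; lia.
move=> /andP[uv /IHp le_vp]; have le_uv := arc_dist_step (last v p) uv.
exact: leq_trans le_uv _.
Qed.

(** One of the two neighbours of u is nearer to v along the shorter arc. *)
Lemma arc_dist_path_exists (u v : 'I_n) :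
  exists p : seq 'I_n,
    [/\ path (@cycle_adj n) u p, last u p = v & size p = arc_dist n u v].
Proof.
move: {2}(arc_dist n u v) (erefl (arc_dist n u v)) => k.
elim: k u => [|k IHk] u dist_uv.
  exists [::]; split=> //; apply: val_inj => /=.
  by move: dist_uv (ltn_ord u) (ltn_ord v); rewrite /arc_dist; lia.
suff [w uw dist_wv] : exists2 w : 'I_n, cycle_adj u w & arc_dist n w v = k.
  have [p [wp last_p size_p]] := IHk w dist_wv.
  by exists (w :: p); rewrite /= uw wp size_p dist_wv dist_uv.
have lt_u := ltn_ord u; have lt_v := ltn_ord v.
pose next := if u.+1 == n then 0 else u.+1.
pose prev := if u == 0 :> nat then n.-1 else u.-1.
have next_lt : next < n by rewrite /next; case: eqP; lia.
have prev_lt : prev < n by rewrite /prev; case: eqP; lia.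
have : arc_dist n next v = k \/ arc_dist n prev v = k.
  move: dist_uv; rewrite /next /prev /arc_dist.
  have [le_uv|lt_vu] := leqP u v.
    have [le_n|gt_n] := leqP (v - u).*2 n; [left|right]; case: eqP; lia.
  have [le_n|gt_n] := leqP (u - v).*2 n; [right|left]; case: eqP; lia.
case=> dist_k; [exists (Ordinal next_lt) | exists (Ordinal prev_lt)] => //.
  apply/cycle_adjP; rewrite /= /next; case: eqP => [?|_].
    by apply: Or44; lia.
  by apply: Or41.
apply/cycle_adjP; rewrite /= /prev; case: eqP => [?|?].
  by apply: Or43; lia.
by apply: Or42; lia.
Qed.

Lemma dist_cycle (u v : 'I_n) : dist (@cycle_adj n) u v = arc_dist n u v.
Proof.
rewrite /dist card_ord.
have [p [up last_p size_p]] := arc_dist_path_exists u v.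
apply/eqP; rewrite eqn_leq; apply/andP; split.
  (* Shortening makes the path duplicate-free, as [dist] requires, without
     making it longer. *)
  move: last_p size_p; case/shortenP: up => q uq uniq_q sub_qp last_q size_p.
  have lt_qn : size q < n.
    have := max_card (mem (u :: q)).
    by rewrite (card_uniqP uniq_q) card_ord.
  have le_q : size q <= arc_dist n u v.
    rewrite -size_p; apply: uniq_leq_size => //.
    by case/andP: uniq_q.
  apply: leq_trans le_q.
  pose P (k : 'I_n) := [exists p : k.-tuple 'I_n,
      [&& path (@cycle_adj n) u p, last u p == v & uniq (u :: p)]].
  have Pq : P (Ordinal lt_qn).
    by apply/existsP; exists (in_tuple q); rewrite uq last_q eqxx.
  exact: (bigminn_leq n (@nat_of_ord n) (mem_index_enum (Ordinal lt_qn)) Pq).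
elim/big_ind: _ => [|a b le_a le_b|k].
- by rewrite /arc_dist; move: (ltn_ord u) (ltn_ord v); lia.
- by rewrite leq_min le_a.
case/existsP=> q /and3P[uq /eqP last_q _].
by have := arc_dist_path uq; rewrite last_q size_tuple.
Qed.

End Cycle.

(** * Sums over pairs of points of a set *)

Section Pairs.
Variable n : nat.
Implicit Types A B : {set 'I_n}.

Lemma big_distance_vector A (f : nat -> nat) :
  \sum_(d <- distance_vector A) f d =
  \sum_(p : 'I_n * 'I_n | [&& p.1 \in A, p.2 \in A & p.1 < p.2])
     f (dist (@cycle_adj n) p.1 p.2).
Proof.
rewrite (perm_big _ (permEl (perm_sort _ _))) big_map big_enum /=.
by apply: eq_bigl => p; rewrite inE.
Qed.

(** Summing over ordered pairs frees the later reindexing by number of steps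
    from the order of the two vertices. *)
Lemma double_sum_pairs A (g : 'I_n -> 'I_n -> nat) :
  (forall u v, g u v = g v u) ->
  \sum_(u in A) \sum_(v in A) g u v =
  \sum_(u in A) g u u
    + (\sum_(p : 'I_n * 'I_n | [&& p.1 \in A, p.2 \in A & p.1 < p.2])
         g p.1 p.2).*2.
Proof.
move=> g_sym.
have pairs_lt : \sum_(p : 'I_n * 'I_n | [&& p.1 \in A, p.2 \in A & p.1 < p.2])
    g p.1 p.2 = \sum_(u in A) \sum_(v in A | u < v) g u v.
  by rewrite pair_big_dep /=; apply: eq_bigl => p; rewrite andbA.
have pairs_gt : \sum_(u in A) \sum_(v in A | u < v) g u v =
    \sum_(u in A) \sum_(v in A | v < u) g u v.
  rewrite (exchange_big_dep (fun v => v \in A)) /=; last by move=> u v _ /andP[].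
  apply: eq_bigr => v vA; apply: eq_big => [u|u _]; last exact: g_sym.
  by rewrite vA.
rewrite -addnn pairs_lt {1}pairs_gt -!big_split /=; apply: eq_bigr => u uA.
rewrite (bigD1 u) //=; congr (_ + _).
rewrite (bigID (fun v : 'I_n => v < u)) /=; congr (_ + _);
  apply: eq_bigl => v; rewrite -(inj_eq val_inj) /=; case: (v \in A) => //=; lia.
Qed.

Lemma size_distance_vector A B :
  #|A| = #|B| -> size (distance_vector A) = size (distance_vector B).
Proof.
have size_eq (C : {set 'I_n}) : #|C| * #|C| = #|C| + (size (distance_vector C)).*2.
  have /= := @double_sum_pairs C (fun _ _ => 1) (fun _ _ => erefl).
  by rewrite -(big_distance_vector C (fun=> 1)) !sum1_size !sum1_card sum_nat_const.
move=> eq_card; have := size_eq A; rewrite eq_card size_eq; lia.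
Qed.

End Pairs.

(** * Windings and their gaps *)

(** A bi-infinite periodic enumeration, restricted to nonnegative indices: it
    makes the clockwise gap from the i-th point to the k-th next one a plain
    difference, without reduction modulo n. *)
Definition winding (n m : nat) (a : nat -> nat) (A : {set 'I_n}) : Prop :=
  [/\ forall i, a i < a i.+1,
      forall i, a (i + m) = a i + n,
      forall i, i < m -> a i < n
    & A = [set x : 'I_n | [exists i : 'I_m, x == a i :> nat]]].

Definition gap (a : nat -> nat) (k i : nat) : nat := a (i + k) - a i.

(** Both sides are the sum over the m + 1 consecutive indices from k on. *)
Lemma sum_shift (m k : nat) (G : nat -> nat) :
  \sum_(i < m) G (i + k.+1) + G k = \sum_(i < m) G (i + k) + G (m + k).
Proof.
have : \sum_(i < m.+1) G (i + k) = \sum_(i < m) G (i + k) + G (m + k).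
  by rewrite big_ord_recr.
rewrite big_ord_recl /= add0n => <-; rewrite addnC; congr (_ + _).
by apply: eq_bigr => i _; rewrite /= /bump leq0n add1n addSnnS.
Qed.

Lemma sum_periodic (m k : nat) (G : nat -> nat) :
  (forall i, G (i + m) = G i) -> \sum_(i < m) G (i + k) = \sum_(i < m) G i.
Proof.
move=> G_per; elim: k => [|k IHk]; first by apply: eq_bigr => i _; rewrite addn0.
by have := sum_shift m k G; rewrite [m + k]addnC G_per IHk => /addIn.
Qed.

Section Winding.
Variables (n m : nat) (a : nat -> nat) (A : {set 'I_n}).
Hypothesis a_wind : winding m a A.

Lemma winding_ltn i j : i < j -> a i < a j.
Proof. by case: a_wind => a_lt _ _ _; exact: (homo_ltn ltn_trans a_lt). Qed.

Lemma winding_leq i j : i <= j -> a i <= a j.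
Proof. by rewrite leq_eqVlt => /predU1P[->//|/winding_ltn/ltnW]. Qed.

Lemma big_winding (G : nat -> nat) : \sum_(u in A) G u = \sum_(i < m) G (a i).
Proof.
case: a_wind => _ _ a_n defA.
pose h (i : 'I_m) := Ordinal (a_n i (ltn_ord i)).
have h_inj : injective h.
  move=> i j /(congr1 val) /= eq_a; apply: val_inj => /=.
  by case: (ltngtP i j) => // /winding_ltn; rewrite eq_a ltnn.
have -> : A = h @: [set: 'I_m].
  rewrite defA; apply/setP=> x; rewrite inE.
  apply/existsP/imsetP => [[i /eqP eq_x]|[i _ ->]]; last by exists i => /=.
  by exists i; rewrite ?inE //; apply: val_inj.
rewrite big_imset /=; last by move=> i j _ _; exact: h_inj.
by apply: eq_bigl => i; rewrite inE.
Qed.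

Lemma card_winding : #|A| = m.
Proof. by rewrite -sum1_card (big_winding (fun=> 1)) sum1_card card_ord. Qed.

Lemma gap_le k i : k <= m -> gap a k i <= n.
Proof.
move=> le_km; case: a_wind => _ a_per _ _.
by rewrite /gap leq_subLR -a_per winding_leq // leq_add2l.
Qed.

(** Each shift of the summation range by one step replaces some a k by
    a (k + m) = a k + n. *)
Lemma sum_gap k : \sum_(i < m) gap a k i = n * k.
Proof.
case: a_wind => _ a_per _ _.
have sum_a : \sum_(i < m) a (i + k) = \sum_(i < m) a i + n * k.
  elim: k => [|k IHk].
    by rewrite muln0 addn0; apply: eq_bigr => i _; rewrite addn0.
  by have := sum_shift m k a; rewrite [m + k]addnC a_per IHk; lia.
have : \sum_(i < m) a (i + k) = \sum_(i < m) gap a k i + \sum_(i < m) a i.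
  rewrite -big_split; apply: eq_bigr => i _ /=.
  by rewrite /gap subnK // winding_leq // leq_addr.
by rewrite sum_a addnC => /addIn.
Qed.

(** Ordered pairs of points are classified by the number k < m of steps from the
    first to the second; the step number 0 gives the diagonal. *)
Lemma sum_pairs_gap (f : nat -> nat) :
  \sum_(u in A) \sum_(v in A) f (arc_dist n u v) =
  \sum_(k < m) \sum_(i < m) f (minn (gap a k i) (n - gap a k i)).
Proof.
case: (a_wind) => a_lt a_per a_n _.
rewrite (big_winding (fun x => \sum_(v in A) f (arc_dist n x v))).
rewrite [RHS]exchange_big /=; apply: eq_bigr => i _.
rewrite (big_winding (fun y => f (arc_dist n (a i) y))).
(* Reducing modulo n makes the summand periodic in j, so that the inner sum may
   start at i. *)
pose G j := f (arc_dist n (a i) (a j %% n)).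
have G_per j : G (j + m) = G j by rewrite /G a_per modnDr.
transitivity (\sum_(j < m) G j).
  by apply: eq_bigr => j _; rewrite /G modn_small ?a_n.
rewrite -(sum_periodic i G_per); apply: eq_bigr => k _.
rewrite /G /gap [k + i]addnC; congr f.
have lt_ai := a_n _ (ltn_ord i).
have [lt_m|le_m] := ltnP (i + k) m.
  rewrite modn_small ?a_n //.
  by have := @winding_leq i (i + k) (leq_addr _ _); rewrite /arc_dist; lia.
have [lt_i lt_k] := (ltn_ord i, ltn_ord k).
have lt_j : i + k - m < i by lia.
have := a_per (i + k - m); rewrite subnK // => ->.
have := winding_ltn lt_j; rewrite modnDr modn_small; last by rewrite a_n //; lia.
by rewrite /arc_dist; lia.
Qed.

End Winding.

Lemma winding_exists (n : nat) (A : {set 'I_n}) :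
  0 < #|A| -> exists a, winding #|A| a A.
Proof.
move=> A_gt0; set m := #|A| in A_gt0 *.
pose s := sort leq (map val (enum A)).
have mem_s x : (x \in s) = [exists u in A, x == val u].
  rewrite mem_sort; apply/mapP/exists_inP => [[u + ->]|[u uA /eqP ->]].
    by rewrite mem_enum => uA; exists u.
  by exists u; rewrite ?mem_enum.
have size_s : size s = m by rewrite size_sort size_map -cardE.
have s_lt i : i < m -> nth 0 s i < n.
  move=> lt_i; have : nth 0 s i \in s by rewrite mem_nth ?size_s.
  by rewrite mem_s => /exists_inP[u _ /eqP ->]; exact: ltn_ord.
have s_sorted : sorted ltn s.
  rewrite ltn_sorted_uniq_leq sort_uniq map_inj_uniq ?enum_uniq //=.
    exact: sort_sorted leq_total _.
  exact: val_inj.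
have s_mono i : i.+1 < m -> nth 0 s i < nth 0 s i.+1.
  move=> lt_i; apply: (sorted_ltn_nth ltn_trans 0 s_sorted) => //;
    by rewrite inE size_s // ltnW.
pose a i := nth 0 s (i %% m) + n * (i %/ m).
have a_block q r : r < m -> a (q * m + r) = nth 0 s r + n * q.
  by move=> lt_r; rewrite /a modnMDl modn_small // divnMDl // divn_small // addn0.
have a_small i : i < m -> a i = nth 0 s i.
  by move=> lt_i; rewrite -[i in LHS]add0n -(mul0n m) a_block // muln0 addn0.
exists a; split=> [i|i|i lt_i|].
- rewrite (divn_eq i m); move: (i %/ m) (i %% m) (ltn_pmod i A_gt0) => q r lt_r.
  rewrite a_block //; have [lt_r1|le_r1] := ltnP r.+1 m.
    by rewrite -[(q * m + r).+1]addnS a_block // ltn_add2r s_mono.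
  have -> : (q * m + r).+1 = q.+1 * m + 0 by lia.
  by rewrite a_block //; have := s_lt _ lt_r; lia.
- by rewrite /a modnDr divnDr // divnn A_gt0; lia.
- by rewrite a_small ?s_lt.
apply/setP=> x; rewrite inE; apply/idP/existsP => [xA|[i /eqP eq_x]].
  have : val x \in s by rewrite mem_s; apply/exists_inP; exists x.
  move=> x_s; have lt_x : index (val x) s < m by rewrite -size_s index_mem.
  by exists (Ordinal lt_x); rewrite /= a_small // nth_index.
have : (x : nat) \in s by rewrite eq_x a_small // mem_nth ?size_s.
by rewrite mem_s => /exists_inP[u uA /eqP/val_inj ->].
Qed.

(** * Balanced windings *)

(** Every gap over k steps is within less than 1 of the mean value n k / m; the
    strict inequality matters when m divides n k. *)
Definition balanced (n m : nat) (a : nat -> nat) : Prop :=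
  forall k i, k < m -> i < m ->
    n * k < m * gap a k i + m /\ m * gap a k i < n * k + m.

Lemma Jset_winding (n m r : nat) : 0 < m <= n -> r < n ->
  winding m (fun i => (n * i + r) %/ m) (Jset n m r).
Proof.
move=> /andP[m_gt0 le_mn] lt_rn; split=> // [i|i|i lt_im].
- have le_div : (n * i + r + m) %/ m <= (n * i.+1 + r) %/ m.
    by apply: leq_div2r; rewrite mulnS; lia.
  by apply: leq_trans le_div; rewrite (divnDr _ (dvdnn m)) divnn m_gt0 addn1.
- by rewrite mulnDr addnAC addnC divnMDl // addnC.
- by rewrite ltn_divLR //; nia.
Qed.

Lemma Jset_balanced (n m r : nat) :
  0 < m -> balanced n m (fun i => (n * i + r) %/ m).
Proof.
move=> m_gt0 k i _ _; rewrite /gap mulnBr mulnDr.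
have := divn_eq (n * i + r) m; have := divn_eq (n * i + n * k + r) m.
have := ltn_pmod (n * i + r) m_gt0; have := ltn_pmod (n * i + n * k + r) m_gt0.
rewrite -![_ %/ m * m]mulnC; lia.
Qed.

(** Being balanced says that the numbers m a i - n i differ by less than m.  If r
    is their maximum, then m a i <= n i + r < m a i + m for all i, which is the
    floor formula.  The last point being below n bounds r. *)
Lemma balanced_Jset (n m : nat) (a : nat -> nat) (A : {set 'I_n}) :
  0 < m -> winding m a A -> balanced n m a ->
  exists2 r, r <= n - 1 & A = Jset n m r.
Proof.
move=> m_gt0 a_wind a_bal; have [_ _ a_n defA] := a_wind.
pose r := \max_(i < m) (m * a i - n * i).
have r_ge (i : 'I_m) : m * a i <= n * i + r.
  by rewrite -leq_subLR; exact: (leq_bigmax i).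
(* The subtraction in r is truncated; the index 0 has a nonnegative value, so
   the maximum is nevertheless that of the true differences. *)
have [j r_eq] : exists j : 'I_m, r + n * j = m * a j.
  have [|j r_j] := @bigop.eq_bigmax 'I_m (fun i => m * a i - n * i).
    by rewrite card_ord.
  rewrite -/r in r_j; have [le_j|lt_j] := leqP (n * j) (m * a j).
    by exists j; rewrite r_j subnK.
  by exists (Ordinal m_gt0); have := r_ge (Ordinal m_gt0) => /=; lia.
have r_lt (i : 'I_m) : n * i + r < m * a i + m.
  have [le_ji|lt_ij] := leqP j i.
    have [|//|+ _] := a_bal (i - j) j; first by have := ltn_ord i; lia.
    rewrite /gap subnKC // !mulnBr.
    have := leq_mul (leqnn n) le_ji.
    by have := leq_mul (leqnn m) (winding_leq a_wind le_ji); lia.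
  have [|//|_ +] := a_bal (j - i) i; first by have := ltn_ord j; lia.
  rewrite /gap (subnKC (ltnW lt_ij)) !mulnBr.
  by have := leq_mul (leqnn n) (ltnW lt_ij); lia.
have a_eq (i : 'I_m) : a i = (n * i + r) %/ m.
  apply/eqP; rewrite eqn_leq leq_divRL // mulnC r_ge -ltnS ltn_divLR //.
  by rewrite mulSn; have := r_lt i; lia.
exists r.
  have lt_m1 : m.-1 < m by rewrite prednK.
  have := r_lt (Ordinal lt_m1); have := a_n _ lt_m1; rewrite /=; nia.
rewrite defA; apply/setP=> x; rewrite !inE.
by apply: eq_existsb => i; rewrite a_eq.
Qed.

Lemma divn_window (m N g : nat) : 0 < m -> N < m * g + m -> m * g < N + m ->
  N %/ m <= g <= (N %/ m).+1.
Proof.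
move=> m_gt0 lt_N lt_g; apply/andP; split.
  by rewrite -ltnS ltn_divLR // mulnC mulnS; lia.
have : g.-1 <= N %/ m by rewrite leq_divRL //; nia.
lia.
Qed.

(** * Capped distance sums *)

(** For t <= n / 2, the supporting line of the concave function min(x, n - x, t)
    along the window {q, q + 1}. *)
Definition tangent (n t q x : nat) : nat :=
  if q < t then x else if q < n - t then t else n - x.

Lemma leq_tangent n t q x : minn (minn x (n - x)) t <= tangent n t q x.
Proof. by rewrite /tangent; case: ifP => _; [|case: ifP => _]; lia. Qed.

Lemma eq_tangent n t q x : t.*2 <= n -> q <= x <= q.+1 -> x <= n ->
  minn (minn x (n - x)) t = tangent n t q x.
Proof. by rewrite /tangent; case: ifP => [?|?]; [|case: ifP => ?]; lia. Qed.

(** The lower end of the window comes from a cap at which min(x, n - x, t) bends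
    at q, the upper end from one at which it bends at q + 1: for q + 1 <= n / 2
    these are t = q and t = q + 1, for q >= n / 2 they are t = n - q and
    t = n - q - 1, and for n = 2 q + 1 the cap t = q bends at both ends. *)
Lemma eq_tangent_bounds n q x : x <= n -> q < n ->
  (forall t, t.*2 <= n -> minn (minn x (n - x)) t = tangent n t q x) ->
  q <= x <= q.+1.
Proof.
rewrite /tangent => le_xn lt_qn eq_t.
have [le_q|lt_q] := leqP q.*2.+2 n.
  have := eq_t q; have := eq_t q.+1; rewrite ltnn ltnSn.
  case: ifP; lia.
have [eq_n|neq_n] := eqVneq n q.*2.+1.
  have := eq_t q; rewrite ltnn; case: ifP; lia.
have [lt1 lt2] : (q < n - q) = false /\ (q < n - (n - q)) = false by lia.
have [lt3 lt4] : (q < n - q.+1) = false /\ (q < n - (n - q.+1)) = true by lia.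
have := eq_t (n - q); have := eq_t (n - q.+1); rewrite lt1 lt2 lt3 lt4; lia.
Qed.

(** The sum of the supporting lines over the gaps of any m-set: they are linear
    and the gaps over k steps add up to n k. *)
Definition capped_bound (n m t : nat) : nat :=
  \sum_(k < m) if n * k %/ m < t then n * k
               else if n * k %/ m < n - t then m * t else m * n - n * k.

Definition capped_sum (n : nat) (A : {set 'I_n}) (t : nat) : nat :=
  \sum_(d <- distance_vector A) minn d t.

Lemma sum_tangent n m a (A : {set 'I_n}) t k : winding m a A -> k < m ->
  \sum_(i < m) tangent n t (n * k %/ m) (gap a k i) =
  if n * k %/ m < t then n * k
  else if n * k %/ m < n - t then m * t else m * n - n * k.
Proof.
move=> a_wind lt_km; rewrite /tangent; case: ifP => _.
  exact: sum_gap a_wind _.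
case: ifP => _; first by rewrite sum_nat_const card_ord.
have gap_n (i : 'I_m) : gap a k i <= n.
  by apply: gap_le a_wind _ _ _; exact: ltnW.
rewrite -(sum_gap a_wind k); apply/esym/eqP.
rewrite -(eqn_add2r (\sum_(i < m) gap a k i)).
rewrite subnK; last first.
  by rewrite -[m in m * n]card_ord -sum_nat_const; apply: leq_sum => i _.
rewrite -big_split /= -[m in m * n]card_ord -sum_nat_const; apply/eqP.
by apply: eq_bigr => i _; rewrite subnK.
Qed.

Section Capped.
Variable n : nat.
Hypothesis n_gt2 : 2 < n.
Implicit Types A B : {set 'I_n}.

Lemma double_capped_sum A t :
  (capped_sum A t).*2 = \sum_(u in A) \sum_(v in A) minn (arc_dist n u v) t.
Proof.
rewrite (@double_sum_pairs n A (fun u v => minn (arc_dist n u v) t)); last first.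
  by move=> u v; rewrite /arc_dist addnC.
rewrite big1 ?add0n => [|u _]; last by rewrite /arc_dist; lia.
rewrite /capped_sum (big_distance_vector A (minn^~ t)); congr (_.*2).
by apply: eq_bigr => p _; rewrite dist_cycle.
Qed.

(** No distance exceeds n / 2, so only caps up to n / 2 matter. *)
Lemma capped_sum_half A t : capped_sum A t = capped_sum A (minn t n./2).
Proof.
apply: double_inj; rewrite !double_capped_sum; apply: eq_bigr => u _.
apply: eq_bigr => v _; rewrite /arc_dist; lia.
Qed.

Lemma capped_sum_leqif m a A t : winding m a A ->
  (capped_sum A t).*2 <= capped_bound n m t
    ?= iff [forall k : 'I_m, forall i : 'I_m,
             minn (minn (gap a k i) (n - gap a k i)) t
               == tangent n t (n * k %/ m) (gap a k i)].
Proof.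
move=> a_wind; rewrite double_capped_sum (sum_pairs_gap a_wind (minn^~ t)).
apply: leqif_sum => k _; rewrite -(sum_tangent t a_wind (ltn_ord k)).
apply: leqif_sum => i _; split=> //; exact: leq_tangent.
Qed.

(** The characterization by extremal capped sums.  In the converse direction,
    the window {q, q + 1} alone allows a gap q + 1 when m divides n k; the sum
    n k = m q of the gaps then excludes it. *)
Lemma maximally_evenP A : 0 < #|A| ->
  maximally_even A <->
  forall t, t.*2 <= n -> (capped_sum A t).*2 = capped_bound n #|A| t.
Proof.
move=> A_gt0; have le_An : #|A| <= n by rewrite -[n in _ <= n]card_ord max_card.
split=> [[r le_r defA] t le_tn|eq_bound].
  have a_wind : winding #|A| (fun i => (n * i + r) %/ #|A|) A.
    by have := @Jset_winding n #|A| r; rewrite -defA; apply; lia.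
  have a_bal := @Jset_balanced n #|A| r A_gt0.
  apply/eqP; rewrite (capped_sum_leqif t a_wind).
  apply/forallP=> k; apply/forallP=> i; apply/eqP/eq_tangent => //; last first.
    by apply: gap_le a_wind _ _ _; exact: ltnW.
  have [lt1 lt2] := a_bal k i (ltn_ord k) (ltn_ord i).
  exact: divn_window.
have [a a_wind] := winding_exists A_gt0.
apply: (balanced_Jset A_gt0 a_wind) => k i lt_km lt_im.
have lt_q : n * k %/ #|A| < n by rewrite ltn_divLR // ltn_pmul2l //; lia.
have gap_q (j : 'I_#|A|) : n * k %/ #|A| <= gap a k j <= (n * k %/ #|A|).+1.
  apply: (@eq_tangent_bounds n) => //.
    by apply: gap_le a_wind _ _ _; exact: ltnW.
  move=> t le_tn; have /eqP := eq_bound t le_tn.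
  rewrite (capped_sum_leqif t a_wind) => /forallP/(_ (Ordinal lt_km)).
  by move=> /forallP/(_ j)/eqP.
have /andP[q_le gap_le1] := gap_q (Ordinal lt_im); rewrite /= in q_le gap_le1.
split.
  apply: leq_trans (ltn_ceil _ A_gt0) _.
  by rewrite mulnC mulnS addnC leq_add2r leq_mul2l q_le orbT.
have le_q := leq_trunc_div (n * k) #|A|.
move: gap_le1; rewrite leq_eqVlt => /predU1P[gap_eq|]; last first.
  by rewrite ltnS => /(leq_mul (leqnn #|A|)); rewrite [_ * (_ %/ _)]mulnC; lia.
suff : #|A| * (n * k %/ #|A|) < n * k by rewrite gap_eq; lia.
rewrite -[ltnRHS](sum_gap a_wind k) -[X in X * _]card_ord -sum_nat_const.
pose C (j : 'I_#|A|) := n * k %/ #|A| == gap a k j.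
rewrite (ltn_leqif (leqif_sum (C := C) _)).
  by apply/forallP=> /(_ (Ordinal lt_im)) /eqP /=; lia.
by move=> j _; split=> //; case/andP: (gap_q j).
Qed.

End Capped.

Lemma capped_sum_max n (A B : {set 'I_n}) t :
  2 < n -> 0 < #|A| -> #|B| = #|A| -> maximally_even A ->
  capped_sum B t <= capped_sum A t.
Proof.
move=> n_gt2 A_gt0 eq_card A_even; rewrite !(capped_sum_half n_gt2 _ t).
have le_tn : (minn t n./2).*2 <= n by lia.
have [b b_wind] : exists b, winding #|B| b B.
  by apply: winding_exists; rewrite eq_card.
rewrite -leq_double (proj1 (maximally_evenP n_gt2 A_gt0) A_even _ le_tn) -eq_card.
by case: (capped_sum_leqif n_gt2 (minn t n./2) b_wind).
Qed.

Lemma sum_dist_capped n (A : {set 'I_n}) : 2 < n -> sum_dist A = capped_sum A n.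
Proof.
move=> n_gt2; rewrite /sum_dist /capped_sum (big_distance_vector A id).
rewrite (big_distance_vector A (minn^~ n)); apply: eq_bigr => p _.
by rewrite dist_cycle // /arc_dist; move: (ltn_ord p.1) (ltn_ord p.2); lia.
Qed.

Lemma maximally_even_majorized (R : realType) n (A B : {set 'I_n}) :
  2 < n -> 0 < #|A| -> #|B| = #|A| -> maximally_even A ->
  maximizes_sum_dist B ->
  majorized (real_vector R (distance_vector A))
            (real_vector R (distance_vector B)).
Proof.
move=> n_gt2 A_gt0 eq_card A_even B_max; apply: majorized_real_vector.
- exact: size_distance_vector.
- apply/eqP; rewrite -!/(sum_dist _) eqn_leq.
  have /forallP/(_ A) := B_max; rewrite eq_card eqxx /= => ->.
  by rewrite !sum_dist_capped // capped_sum_max.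
- by move=> t; exact: capped_sum_max.
Qed.

Theorem theorem4 (R : realType) (n m : nat) (hn : (3 <= n)%N)
    (hm : (1 <= m <= n)%N) (A : {set 'I_n}) (hA : #|A| = m) :
  maximally_even A <->
  (forall B : {set 'I_n}, B \in sum_dist_maximizers n m ->
     majorized (real_vector R (distance_vector A))
               (real_vector R (distance_vector B))).
Proof.
have A_gt0 : 0 < #|A| by rewrite hA; case/andP: hm.
split=> [A_even B|A_maj].
  rewrite inE -hA => /andP[/eqP eq_card B_max].
  exact: maximally_even_majorized.
pose J := Jset n m 0.
have J_card : #|J| = m by apply: card_winding (Jset_winding hm _); lia.
have J_gt0 : 0 < #|J| by rewrite J_card -hA.
have J_even : maximally_even J by exists 0; rewrite ?J_card.
have J_max : maximizes_sum_dist J.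
  apply/forallP=> B; apply/implyP=> /eqP eq_card.
  by rewrite !sum_dist_capped // capped_sum_max.
have maj_AJ := A_maj J; rewrite inE J_card eqxx J_max in maj_AJ.
have A_max : maximizes_sum_dist A.
  apply/forallP=> B; have /forallP/(_ B) := J_max.
  by rewrite J_card hA /sum_dist (majorized_sum_real_vector (maj_AJ isT)).
have maj_JA : majorized (real_vector R (distance_vector J))
                        (real_vector R (distance_vector A)).
  by apply: maximally_even_majorized => //; rewrite J_card.
have eq_D := perm_real_vector (majorized_anti (maj_AJ isT) maj_JA).
apply/maximally_evenP=> // t le_tn; rewrite hA -J_card.
rewrite -(proj1 (maximally_evenP hn J_gt0) J_even t le_tn).
by congr (_.*2); exact: perm_big.
Qed.
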